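(* For all integers $p,q\geq 2$, the sum $\sum_{i+j=p-1,\ i,j\geq 0}\binom{p+i-1}{i}\binom{q+j-1}{j}T(p+i,q+j)$ is reducible to zeta values (i.e. lies in $\mathbb{Q}[\text{zeta values}]$): $$\begin{aligned}\sum_{\substack{i+j=p-1\\ i,j\geq 0}}\binom{p+i-1}{i}\binom{q+j-1}{j}T(p+i,q+j)&=\frac{(-1)^p}{2^{2p+q-2}}\binom{2p+q-2}{q-1}\tilde t(2p+q-1)\\&\quad+\frac{1}{2^{2p+q-3}}\sum_{\substack{i+j=p-1\\ i,j\geq 0}}\binom{p+i-1}{i}\binom{q+j-1}{j}\bigl(1+(-1)^{p+i}\bigr)\zeta(p+i)\,\tilde t(q+j)\\&\quad-\frac{(-1)^p}{2^{2p+q-2}}\sum_{\substack{i+j=q-1\\ i,j\geq 0}}\binom{p+i-1}{i}\binom{p+j-1}{j}\tilde t(p+i)\,\tilde t(p+j).\end{aligned}$$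
   Context: For integers $a\geq 2$, $b\geq 1$, the double $T$-value is $T(a,b)=4\sum_{n_1>n_2\geq 1}\frac{1}{(2n_1-2)^{a}(2n_2-1)^{b}}$. For integers $s\geq 2$: $\zeta(s)=\sum_{n\geq1}n^{-s}$ is the Riemann zeta value and $\tilde t(s)=\sum_{n=1}^\infty\frac{1}{(n-1/2)^s}=(2^s-1)\zeta(s)$. $\mathbb{Q}[\text{zeta values}]$ denotes the $\mathbb{Q}$-subalgebra of $\mathbb{R}$ generated by the numbers $\zeta(k)$, $k\geq 2$ an integer. *)

(* Defs.v *)
From HB Require Import structures.
From mathcomp Require Import all_boot all_order all_algebra.
From mathcomp Require Import all_classical all_reals all_analysis.

Set Implicit Arguments.
Unset Strict Implicit.
Unset Printing Implicit Defensive.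

Import Order.TTheory GRing.Theory Num.Theory.
Import numFieldNormedType.Exports.

Local Open Scope classical_set_scope.
Local Open Scope ring_scope.

(* The series below are limits of real partial sums.  They converge for s >= 2
   and, for the double T-value, a >= 2 and b >= 1; outside of this range [lim]
   returns an unspecified value. *)

Definition zeta (R : realType) (s : nat) : R :=
  limn (fun N => \sum_(1 <= n < N) (n%:R ^+ s)^-1 : R).

Definition ttilde (R : realType) (s : nat) : R :=
  limn (fun N => \sum_(1 <= n < N) ((n%:R - 2^-1) ^+ s)^-1 : R).

(* At n1 = 1 the inner sum is empty, so the zero of 2 * n1 - 2 is harmless.
   All terms are positive, so the order of summation does not matter. *)
Definition Tval (R : realType) (a b : nat) : R :=
  4 * limn (fun N => \sum_(1 <= n1 < N) \sum_(1 <= n2 < n1)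
                       ((2 * n1%:R - 2) ^+ a * (2 * n2%:R - 1) ^+ b)^-1 : R).

(* As in [GRing.subalg_closed], with rational scalars acting on R by [ratr];
   [1 \in A] and linearity give [0 \in A] with (a, x, y) = (-1, 1, 1). *)
Definition Qsubalgebra (R : realType) (A : set R) : Prop :=
  [/\ A 1,
      forall (a : rat) (x y : R), A x -> A y -> A (ratr a * x + y)
    & forall x y : R, A x -> A y -> A (x * y)].

Definition zeta_values (R : realType) : set R :=
  [set zeta R k | k in [set k : nat | (2 <= k)%N]].

Arguments zeta_values : clear implicits.

Definition Qzeta (R : realType) : set R :=
  smallest (@Qsubalgebra R) (zeta_values R).
Arguments Qzeta : clear implicits.

(* Main.v *)
Require Import Defs.
From HB Require Import structures.
From mathcomp Require Import all_boot all_order all_algebra.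
From mathcomp Require Import all_classical all_reals all_analysis.
From mathcomp Require Import zify ring lra.

Import Order.TTheory GRing.Theory Num.Theory.
Import numFieldNormedType.Exports.
Local Open Scope classical_set_scope.
Local Open Scope ring_scope.

(** The product of binomial coefficients in the theorem is a residue: the
    number

      F(a, x) = sum_(i + j = p - 1) C(p+i-1, i) C(q+j-1, j) a^-(p+i) x^-(q+j)

    is the coefficient of z^(p-1) in (a - z)^-p (x - z)^-q, that is, the
    residue at z = 0 of z^-p (a - z)^-p (x - z)^-q.  Up to the factor
    4 / 2^(2p+q-1), the sum of double T-values is the sum of F(a, x) over the
    integers a and the half-integers x with a > x > 0.

    Let x and y be distinct positive half-integers and a = x - y.  The
    residues of z^-p (a - z)^-p (x - z)^-q at its three poles 0, a and x add
    up to zero.  The residue at a is F(y - x, y), and the one at x is, up to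
    sign, the coefficient G(x, y) of z^(q-1) in (x - z)^-p (y - z)^-p; hence

      F(x - y, x) + F(y - x, y) = (-1)^p G(x, y)        ([res0_sum]).

    Summing over all pairs x <> y below a bound N, the left-hand side counts
    every F(x - y, x) twice.  On the right, the sum of G over the full square
    is a combination of products of partial sums of ttilde, and the diagonal
    y = x, which has to be removed, gives C(2p+q-2, q-1) x^-(2p+q-1) by
    Vandermonde's identity ([res0_diag]).  This is [res0_box].

    On the left, for fixed x, the integer a = x - y runs over the positive
    integers below x and over the negative integers above x - N.  In the limit
    this is every nonzero a except those with a > x: the nonzero integers a
    give the terms (1 + (-1)^(p+i)) zeta(p+i) ttilde(q+j), and those with
    a > x are the double T-values ([cvg_punctured_box]).  The two expressions
    for the limit give the formula, and ttilde(s) = (2^s - 1) zeta(s)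
    ([ttilde_zeta]) shows that its right-hand side lies in the algebra
    generated by the zeta values. *)

(** * Residues of a product of three powers *)

(** The coefficient of z^i in (u - z)^-m.  The truncated subtraction is harmless:
    for m = 0 the formula gives the coefficients of the constant series 1. *)
Definition invpow_coef (F : fieldType) (m : nat) (u : F) (i : nat) : F :=
  'C(m + i - 1, i)%:R / u ^+ (m + i).

(** The residue at z = 0 of z^-l (u - z)^-m (v - z)^-n. *)
Definition res0 (F : fieldType) (l m n : nat) (u v : F) : F :=
  \sum_(i < l) invpow_coef F m u i * invpow_coef F n v (l.-1 - i).

Lemma invpow_coef_power0 (F : fieldType) (u : F) i :
  invpow_coef F 0 u i = (i == 0%N)%:R.
Proof.
rewrite /invpow_coef add0n; case: i => [|i] /=; first by rewrite bin0 expr0 divr1.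
by rewrite subn1 bin_small // mul0r.
Qed.

(** The identity (u - z) (u - z)^-(m+1) = (u - z)^-m, read on coefficients. *)
Lemma invpow_coefS (F : fieldType) (m : nat) (u : F) (i : nat) (u0 : u != 0) :
  u * invpow_coef F m.+1 u i =
  invpow_coef F m u i + (if i is i'.+1 then invpow_coef F m.+1 u i' else 0).
Proof.
rewrite /invpow_coef; case: i => [|i].
  by rewrite !bin0 !addn0 !div1r addr0 exprS; field; rewrite u0 expf_neq0.
rewrite addSn subn1 /= addnS !subn1 /= addSn /= binS natrD mulrDl exprS.
rewrite mulrDr; congr (_ + _);
  by field; rewrite u0 ?expf_neq0.
Qed.

(** Up to sign, the two sides are the residues of z^-l (u - z)^-k at its poles 0
    and u, which add up to zero. *)
Lemma invpow_coef_sym (F : fieldType) (k l : nat) (u : F) :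
  (0 < k)%N -> (0 < l)%N ->
  invpow_coef F k u l.-1 = invpow_coef F l u k.-1.
Proof.
case: k => // k; case: l => // l _ _ /=.
rewrite /invpow_coef !addSn !subn1 /= (addnC l k).
by rewrite -[X in X%:R / _ = _]bin_sub ?leq_addl // addnK.
Qed.

Lemma res0_sym (F : fieldType) l m n (u v : F) :
  res0 F l m n u v = res0 F l n m v u.
Proof.
rewrite /res0 (reindex_inj rev_ord_inj) /=; apply: eq_bigr => i _.
rewrite mulrC; have := ltn_ord i => li.
by congr (invpow_coef _ _ _ _ * invpow_coef _ _ _ _); lia.
Qed.

(** The partial fraction u / (z (u - z)) = 1 / z + 1 / (u - z). *)
Lemma res0_parfrac0 (F : fieldType) l m n (u v : F) (u0 : u != 0) :
  u * res0 F l.+1 m.+1 n u v = res0 F l.+1 m n u v + res0 F l m.+1 n u v.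
Proof.
rewrite /res0 mulr_sumr.
under eq_bigr => i _ do rewrite mulrA (@invpow_coefS F m u i u0) mulrDl.
rewrite big_split /=; congr (_ + _).
rewrite big_ord_recl /= mul0r add0r; apply: eq_bigr => i _.
by congr (_ * invpow_coef _ _ _ _); rewrite /= /bump /=; lia.
Qed.

(** The partial fraction (v - u) / ((u - z) (v - z)) = 1 / (u - z) - 1 / (v - z).
    It follows from the previous one, used once with u and once with v: the
    two terms of pole order l - 1 cancel. *)
Lemma res0_parfrac (F : fieldType) l m n (u v : F) (u0 : u != 0) (v0 : v != 0) :
  (v - u) * res0 F l m.+1 n.+1 u v = res0 F l m.+1 n u v - res0 F l m n.+1 u v.
Proof.
case: l => [|l]; first by rewrite /res0 !big_ord0 mulr0 subr0.
rewrite mulrBl res0_parfrac0 // [res0 _ _ m.+1 n.+1 _ _]res0_sym.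
rewrite res0_parfrac0 // [res0 _ _ n m.+1 _ _]res0_sym.
by rewrite [res0 _ _ n.+1 m.+1 _ _]res0_sym; ring.
Qed.

Lemma res0_power0 (F : fieldType) l n (u v : F) (l0 : (0 < l)%N) :
  res0 F l 0 n u v = invpow_coef F n v l.-1.
Proof.
case: l l0 => // l _; rewrite /res0 big_ord_recl /= invpow_coef_power0 mul1r subn0.
by rewrite big1 ?addr0 // => i _; rewrite invpow_coef_power0 mul0r.
Qed.

(** Vandermonde's identity: when u = v, the two factors merge into
    (u - z)^-(m+n). *)
Lemma res0_diag (F : fieldType) l m n (u : F) (u0 : u != 0) :
  res0 F l.+1 m n u u = invpow_coef F (m + n) u l.
Proof.
elim: m l => [|m IHm] l; first by rewrite res0_power0.
elim: l => [|l IHl]; apply: (mulfI u0); rewrite res0_parfrac0 // addSn invpow_coefS //.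
  by rewrite IHm /res0 big_ord0.
by rewrite IHm IHl.
Qed.

(** The residue theorem for z^-l (a - z)^-m (x - z)^-n with a = x - y: the
    three terms are the residues at 0, a and x after translation of each pole
    to 0, and 2 <= n makes the residue at infinity vanish.  The partial
    fractions in the poles 0 and a reduce the orders (l+1, m+1) to (l+1, m) and
    (l, m+1), so by induction only two poles remain, where the identity is
    [invpow_coef_sym]. *)
Lemma res0_sum (F : fieldType) l m n (x y : F) :
  x != 0 -> y != 0 -> x != y -> (2 <= n)%N ->
  res0 F l m n (x - y) x + (-1) ^+ (l + m) * res0 F m l n (y - x) y =
  (-1) ^+ m * res0 F n l m x y.
Proof.
move=> x0 y0 xy n2.
have n0 : (0 < n)%N by lia.
have n2f : (n.-1 == 0%N) = false by apply/eqP; lia.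
have res00 m' n' u v : res0 F 0 m' n' u v = 0 by rewrite /res0 big_ord0.
(* If l = 0 there is no pole at 0, and if m = 0 there is none at x - y. *)
elim: l m => [|l IHl] m.
  rewrite res00 add0r add0n [RHS]mulrC mulrC; congr (_ * _).
  rewrite [RHS]res0_power0 //.
  case: m => [|m]; first by rewrite res00 invpow_coef_power0 n2f.
  by rewrite res0_power0 // invpow_coef_sym.
elim: m => [|m IHm].
  rewrite res00 mulr0 addr0 expr0 mul1r res0_power0 //.
  by rewrite [RHS]res0_sym res0_power0 // invpow_coef_sym.
have a0 : x - y != 0 by rewrite subr_eq0.
have b0 : y - x != 0 by rewrite subr_eq0 eq_sym.
have -> : (-1 : F) ^+ (l.+1 + m.+1) = (-1) ^+ (l + m).
  by rewrite addSn addnS !exprS !mulN1r opprK.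
apply: (mulfI a0).
have A1 := res0_parfrac0 F l m n (x - y) x a0.
have A2 := res0_parfrac0 F m l n (y - x) y b0.
have B1 := res0_parfrac F n l m x y x0 y0.
have := IHl m.+1; rewrite addnS !exprS => P1.
move: IHm; rewrite addSn !exprS => P2.
rewrite mulrDr A1.
have -> : (x - y) * ((-1) ^+ (l + m) * res0 F m.+1 l.+1 n (y - x) y)
  = - ((-1) ^+ (l + m) * ((y - x) * res0 F m.+1 l.+1 n (y - x) y)) by ring.
have -> : (x - y) * (-1 * (-1) ^+ m * res0 F n l.+1 m.+1 x y)
  = (-1) ^+ m * ((y - x) * res0 F n l.+1 m.+1 x y) by ring.
rewrite A2 B1.
transitivity ((-1 * (-1) ^+ m * res0 F n l m.+1 x y)
   + ((-1) ^+ m * res0 F n l.+1 m x y)); last by ring.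
by rewrite -P1 -P2; ring.
Qed.

(** * Convergence of the zeta, ttilde and double T series *)

Definition psum (R : realType) (u : nat -> R) (N : nat) : R :=
  \sum_(1 <= n < N) u n.

Definition zterm (R : realType) (s n : nat) : R := (n%:R ^+ s)^-1.

Definition tterm (R : realType) (s n : nat) : R := ((n%:R - 2^-1) ^+ s)^-1.

Lemma psum1 (R : realType) (u : nat -> R) : psum R u 1 = 0.
Proof. by rewrite /psum big_geq. Qed.

Lemma psumS (R : realType) (u : nat -> R) N :
  psum R u N.+2 = psum R u N.+1 + u N.+1.
Proof. by rewrite /psum big_nat_recr. Qed.

Lemma psum_nondecreasing (R : realType) (u : nat -> R) :
  (forall n, (0 < n)%N -> 0 <= u n) ->
  {homo psum R u : m n / (m <= n)%N >-> m <= n}.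
Proof.
move=> u0; apply: homo_leq => [x|y x z|[|N]]; [exact: lexx|exact: le_trans| |].
  by rewrite /psum !big_geq.
by rewrite psumS lerDl u0.
Qed.

Lemma psum_ge0 (R : realType) (u : nat -> R) N :
  (forall n, (0 < n)%N -> 0 <= u n) -> 0 <= psum R u N.
Proof.
move=> u0; apply: le_trans (psum_nondecreasing R u u0 0%N N _) => //.
by rewrite /psum big_geq.
Qed.

Lemma psum_le_lim (R : realType) (u : nat -> R) N (l : R) :
  (forall n, (0 < n)%N -> 0 <= u n) -> psum R u @ \oo --> l -> psum R u N <= l.
Proof.
move=> u0 cu; rewrite -(cvg_lim _ cu) //.
apply: nondecreasing_cvgn_le; first exact: psum_nondecreasing.
by apply/cvg_ex; exists l.
Qed.

Lemma psum_cvg_le (R : realType) (u : nat -> R) (M : R) :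
  (forall n, (0 < n)%N -> 0 <= u n) -> (forall N, psum R u N <= M) ->
  cvgn (psum R u).
Proof.
move=> u0 uM; apply: nondecreasing_is_cvgn; first exact: psum_nondecreasing.
by exists M => _ [N _ <-].
Qed.

Lemma zterm_ge0 (R : realType) s n : 0 <= zterm R s n.
Proof. by rewrite invr_ge0 exprn_ge0. Qed.

Lemma tterm_ge0 (R : realType) s n : (0 < n)%N -> 0 <= tterm R s n.
Proof.
case: n => // n _; rewrite invr_ge0 exprn_ge0 // subr_ge0 -(natr1 n).
by have := ler0n R n; lra.
Qed.

(** Comparison with the telescoping series of 1/n - 1/(n+1). *)
Lemma cvg_zeta (R : realType) s : (2 <= s)%N -> cvgn (psum R (zterm R s)).
Proof.
move=> s2; apply: (psum_cvg_le R _ 2) => [n _|]; first exact: zterm_ge0.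
have bound N : psum R (zterm R s) N.+2 <= 2 - N.+1%:R^-1.
  elim: N => [|N IHN]; first by rewrite psumS psum1 /zterm expr1n invr1; lra.
  rewrite psumS; have a0 : 0 < N.+1%:R :> R by [].
  have : zterm R s N.+2 <= (N.+2%:R ^+ 2)^-1.
    rewrite /zterm lef_pV2 ?posrE ?exprn_gt0 // ler_weXn2l //.
    by rewrite ler1n.
  have : (N.+2%:R ^+ 2)^-1 <= N.+1%:R^-1 - N.+2%:R^-1 :> R.
    have -> : N.+1%:R^-1 - N.+2%:R^-1 = (N.+1%:R * N.+2%:R)^-1 :> R.
      rewrite -(natr1 N.+1); move: (N.+1%:R) a0 => a a0.
      by field; rewrite ?gt_eqF //; lra.
    by rewrite lef_pV2 ?posrE ?mulr_gt0 // expr2 ler_wpM2r // ler_nat.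
  move: IHN; set P := psum _ _ _; set Z := zterm _ _ _; set c := _ ^-1.
  by set d := _^-1; set e := _^-1 => ? ? ?; lra.
case=> [|[|N]]; [by rewrite /psum big_geq|by rewrite psum1|].
by apply: le_trans (bound N) _; rewrite gerBl invr_ge0.
Qed.

(** Among the integers up to 2N, the even ones give the terms of zeta and the
    odd ones those of ttilde, both scaled by 2^-s. *)
Lemma psum_tterm (R : realType) s N :
  psum R (tterm R s) N.+1 =
  2 ^+ s * psum R (zterm R s) N.*2.+1 - psum R (zterm R s) N.+1.
Proof.
elim: N => [|N IHN]; first by rewrite !psum1 mulr0 subr0.
rewrite doubleS !psumS IHN !mulrDr.
have -> : 2 ^+ s * zterm R s N.*2.+2 = zterm R s N.+1.
  by rewrite /zterm -doubleS -muln2 natrM exprMn invfM mulrCA mulfV ?mulr1.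
have -> : 2 ^+ s * zterm R s N.*2.+1 = tterm R s N.+1.
  rewrite /zterm /tterm -[X in X * _]invrK -invfM -exprVn -exprMn.
  congr ((_ ^+ _)^-1); rewrite -(natr1 N.*2) -(natr1 N) -muln2 natrM.
  by field.
by ring.
Qed.

Lemma cvg_ttilde_zeta (R : realType) s : (2 <= s)%N ->
  psum R (tterm R s) N @[N --> \oo] --> (2 ^+ s - 1) * zeta R s.
Proof.
move=> s2; have cz : psum R (zterm R s) N @[N --> \oo] --> zeta R s := cvg_zeta R s s2.
rewrite -cvg_shiftS; under eq_fun do rewrite psum_tterm.
rewrite mulrBl mul1r; apply: cvgB; last by rewrite (cvg_shiftS (psum R (zterm R s))).
apply: cvgMl_tmp.
apply: (@cvg_comp _ _ _ (fun N => N.*2.+1) (psum R (zterm R s)) _ _ _ _ cz).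
by apply/cvgnyPge => A; exists A => // N /=; lia.
Qed.

Lemma ttilde_zeta (R : realType) s : (2 <= s)%N ->
  ttilde R s = (2 ^+ s - 1) * zeta R s.
Proof. by move=> s2; apply: cvg_lim => //; apply: cvg_ttilde_zeta. Qed.

Lemma cvg_ttilde (R : realType) s : (2 <= s)%N ->
  psum R (tterm R s) N @[N --> \oo] --> ttilde R s.
Proof. by move=> s2; rewrite ttilde_zeta //; apply: cvg_ttilde_zeta. Qed.

(** The pairs (a, k) of indices in a square are split into those with k <= a and
    those with a < k. *)
Lemma psum_triangles (R : realType) (u v : nat -> R) N :
  psum R (fun a => u a * psum R v a.+1) N + psum R (fun k => v k * psum R u k) N =
  psum R u N * psum R v N.
Proof.
case: N => [|N]; first by rewrite /psum !big_geq // addr0 mul0r.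
elim: N => [|N IHN]; first by rewrite !psum1 addr0 mul0r.
by rewrite !psumS [RHS]mulrDl !mulrDr -IHN; ring.
Qed.

(** A sum of nonnegative terms over the triangle a + k < N lies between the sums
    over the squares of sides N / 2 and N, which have the same limit. *)
Lemma cvg_psum_antidiagonal (R : realType) (u v : nat -> R) (a b : R) :
  (forall n, (0 < n)%N -> 0 <= u n) -> (forall n, (0 < n)%N -> 0 <= v n) ->
  psum R u @ \oo --> a -> psum R v @ \oo --> b ->
  \sum_(1 <= k < N) v k * psum R u (N - k) @[N --> \oo] --> a * b.
Proof.
move=> u0 v0 ca cb.
have u0' N := psum_ge0 R u N u0.
have half (w : nat -> R) c : psum R w @ \oo --> c ->
    psum R w (N %/ 2) @[N --> \oo] --> c.
  by move=> cw; apply: (@cvg_comp _ _ _ (fun N => N %/ 2)%N _ _ _ _ _ cw); exact: cvg_divnr.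
apply: (@squeeze_cvgr _ _ _ _ (fun N => psum R u (N %/ 2) * psum R v (N %/ 2))
  (fun N => psum R u N * psum R v N)).
- near=> N; rewrite !(mulrC (psum R u _)); apply/andP; split.
    have vu0 k : (0 < k)%N -> 0 <= v k * psum R u (N - k).
      by move=> k0; rewrite mulr_ge0 ?v0.
    apply: le_trans (psum_nondecreasing R _ vu0 (N %/ 2)%N N (leq_div _ _)).
    rewrite mulr_suml; apply: ler_sum_nat => k /andP[k0 kN].
    rewrite ler_wpM2l ?v0 //; apply: psum_nondecreasing => //; lia.
  rewrite mulr_suml; apply: ler_sum_nat => k /andP[k0 kN].
  by rewrite ler_wpM2l ?v0 //; apply: psum_nondecreasing => //; exact: leq_subr.
- by apply: cvgM; apply: half.
- exact: cvgM.
Unshelve. all: by end_near. Qed.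

(** The substitution n1 = a + 1, after which the term a = 0 vanishes because its
    inner sum is empty. *)
Lemma Tval_partial (R : realType) s t N :
  \sum_(1 <= n1 < N.+1) \sum_(1 <= n2 < n1)
     ((2 * n1%:R - 2) ^+ s * (2 * n2%:R - 1) ^+ t)^-1 =
  (2 ^+ (s + t))^-1 * psum R (fun a => zterm R s a * psum R (tterm R t) a.+1) N.
Proof.
pose A m := (2 ^+ (s + t))^-1 * (zterm R s m * psum R (tterm R t) m.+1).
rewrite big_add1 /= (eq_bigr A) => [|m _].
  case: N => [|N]; first by rewrite /psum !big_geq // mulr0.
  by rewrite big_ltn // {1}/A psum1 !mulr0 add0r /psum mulr_sumr.
rewrite /A /psum !mulr_sumr; apply: eq_bigr => k _.
rewrite /zterm /tterm -!invfM; congr (_^-1).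
rewrite exprD [RHS]mulrACA -!exprMn -(natr1 m).
by congr (_ ^+ _ * _ ^+ _); field.
Qed.

Lemma cvg_Tval (R : realType) s t : (2 <= s)%N -> (2 <= t)%N ->
  psum R (fun a => zterm R s a * psum R (tterm R t) a.+1) @ \oo -->
  2 ^+ (s + t) / 4 * Tval R s t.
Proof.
move=> s2 t2; set A := psum R _.
have cz : psum R (zterm R s) @ \oo --> zeta R s := cvg_zeta R s s2.
have ct := cvg_ttilde R t t2.
have pt N := psum_ge0 R (tterm R t) N (tterm_ge0 R t).
have cA : cvgn A.
  apply: (psum_cvg_le R _ (zeta R s * ttilde R t)) => [n _|N].
    by rewrite mulr_ge0 ?zterm_ge0.
  apply: (@le_trans _ _ (psum R (zterm R s) N * ttilde R t)).
    rewrite /psum mulr_suml; apply: ler_sum_nat => n _.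
    by rewrite ler_wpM2l ?zterm_ge0 //; apply: psum_le_lim => //; apply: tterm_ge0.
  have z0 n : (0 < n)%N -> 0 <= zterm R s n by move=> _; exact: zterm_ge0.
  rewrite ler_wpM2r ?(psum_le_lim R _ _ _ z0) //.
  apply: le_trans (pt 0%N) _; apply: psum_le_lim => //; exact: tterm_ge0.
suff -> : Tval R s t = 4 * ((2 ^+ (s + t))^-1 * limn A).
  suff -> : 2 ^+ (s + t) / 4 * (4 * ((2 ^+ (s + t))^-1 * limn A)) = limn A by [].
  by field; rewrite expf_neq0.
rewrite /Tval; congr (_ * _); apply: cvg_lim => //.
rewrite -cvg_shiftS; under eq_fun do rewrite Tval_partial.
exact: cvgMl_tmp.
Qed.

(** The terms with l < k and with l > k are reindexed by a = k - l and a = l - k.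
    The term l = k is zero since the inverse of 0 is 0, so the row is punctured
    without any side condition. *)
Lemma sum_punctured_row (R : realType) s N k : (0 < s)%N -> (0 < k < N)%N ->
  \sum_(1 <= l < N) ((k%:R - l%:R) ^+ s)^-1 =
  psum R (zterm R s) k + (-1) ^+ s * psum R (zterm R s) (N - k).
Proof.
move=> s0 /andP[k0 kN]; rewrite (big_cat_nat _ (n := k)) //=; last exact: ltnW.
congr (_ + _).
  rewrite big_nat_rev; apply: eq_big_nat => i /andP[i0 ik].
  rewrite /zterm natrB; last by lia.
  by congr ((_ ^+ _)^-1); rewrite -(natr1 i) natrD; ring.
rewrite big_ltn // subrr expr0n gtn_eqF // invr0 add0r.
rewrite -{1}(add1n k) big_addn /psum mulr_sumr; apply: eq_big_nat => i _.
rewrite /zterm natrD opprD addrC subrK [in LHS]exprNn invfM; congr (_ * _).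
by rewrite -exprVn invrN invr1.
Qed.

(** By [sum_punctured_row] this is a sum over x < N of x^-t times a sum over
    nonzero integers a with x - N < a < x.  The positive a contribute the whole
    square zeta * ttilde minus the part a > x, which is the double T-value; the
    negative a contribute a sum over a triangle, which has the same
    limit as the sum over the square. *)
Lemma cvg_punctured_box (R : realType) s t : (2 <= s)%N -> (2 <= t)%N ->
  \sum_(1 <= k < N) tterm R t k * \sum_(1 <= l < N) ((k%:R - l%:R) ^+ s)^-1
    @[N --> \oo] -->
  (1 + (-1) ^+ s) * zeta R s * ttilde R t - 2 ^+ (s + t) / 4 * Tval R s t.
Proof.
move=> s2 t2.
have cz : psum R (zterm R s) @ \oo --> zeta R s := cvg_zeta R s s2.
have ct := cvg_ttilde R t t2.
have z0 n : (0 < n)%N -> 0 <= zterm R s n by move=> _; exact: zterm_ge0.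
have E N : \sum_(1 <= k < N) tterm R t k * \sum_(1 <= l < N) ((k%:R - l%:R) ^+ s)^-1
  = psum R (zterm R s) N * psum R (tterm R t) N
    - psum R (fun a => zterm R s a * psum R (tterm R t) a.+1) N
    + (-1) ^+ s * (\sum_(1 <= k < N) tterm R t k * psum R (zterm R s) (N - k)).
  rewrite -psum_triangles [_ + _ - _]addrAC subrr add0r /psum mulr_sumr -big_split.
  apply: eq_big_nat => k kN; rewrite sum_punctured_row //; last by lia.
  by rewrite /= mulrDr mulrCA.
under eq_fun do rewrite E.
have -> : (1 + (-1) ^+ s) * zeta R s * ttilde R t - 2 ^+ (s + t) / 4 * Tval R s t =
  zeta R s * ttilde R t - 2 ^+ (s + t) / 4 * Tval R s t
  + (-1) ^+ s * (zeta R s * ttilde R t) by ring.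
apply: cvgD; first by apply: cvgB; [exact: cvgM|exact: cvg_Tval].
by apply: cvgMl_tmp; apply: cvg_psum_antidiagonal => //; apply: tterm_ge0.
Qed.

(** * Summing the residue identity over a box *)

Lemma sum_antidiagonal (V : nmodType) n (f : nat -> nat -> V) : (0 < n)%N ->
  \sum_(i < n) \sum_(j < n | (i + j == n - 1)%N) f i j =
  \sum_(i < n) f i (n.-1 - i)%N.
Proof.
move=> n0; apply: eq_bigr => i _; have := ltn_ord i => ilt.
rewrite (big_pred1 (rev_ord i)) /= => [|j]; first by congr (f _ _); lia.
by apply/eqP/eqP => [ij|->]; [apply: val_inj|] => /=; lia.
Qed.

Lemma half_integer_neq0 (R : realType) k : k%:R - 2^-1 != 0 :> R.
Proof.
case: k => [|k]; first by rewrite sub0r oppr_eq0 invr_eq0.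
by rewrite -(natr1 k); have := ler0n R k => k0; apply/eqP; lra.
Qed.

(** The sum is symmetrized in k and l: off the diagonal [res0_sum] applies, and
    on the diagonal the summand is zero because the inverse of 0 is 0. *)
Lemma res0_box (R : realType) p q N : (0 < p)%N -> (2 <= q)%N ->
  2 * (\sum_(1 <= k < N) \sum_(1 <= l < N)
         res0 R p p q (k%:R - l%:R) (k%:R - 2^-1)) =
  (-1) ^+ p *
    ((\sum_(1 <= k < N) \sum_(1 <= l < N)
        res0 R q p p (k%:R - 2^-1) (l%:R - 2^-1))
     - 'C(2 * p + q - 2, q - 1)%:R * psum R (tterm R (2 * p + q - 1)) N).
Proof.
move=> p0 q2; pose X k : R := k%:R - 2^-1.
pose f k l := res0 R p p q (k%:R - l%:R) (X k).
pose g k l := res0 R q p p (X k) (X l).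
have X0 k : X k != 0 by exact: half_integer_neq0.
have fg k l : f k l + f l k = (-1) ^+ p * (g k l - (if k == l then g k k else 0)).
  case: eqP => [<-|/eqP kl].
    rewrite subrr mulr0 /f subrr /res0 -big_split big1 //= => i _.
    by rewrite /invpow_coef expr0n addn_eq0 (gtn_eqF p0) invr0 mulr0 !mul0r addr0.
  have Xkl : X k - X l = k%:R - l%:R by rewrite /X; ring.
  have Xlk : X l - X k = l%:R - k%:R by rewrite /X; ring.
  have neq : X k != X l by rewrite (can_eq (subrK _)) eqr_nat.
  have := res0_sum R p p q (X k) (X l) (X0 k) (X0 l) neq q2.
  by rewrite Xkl Xlk -signr_odd addnn odd_double expr0 mul1r subr0.
have gdiag k : g k k = 'C(2 * p + q - 2, q - 1)%:R * tterm R (2 * p + q - 1) k.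
  rewrite /g; case: q q2 {f fg g} => // q q2; rewrite res0_diag // /invpow_coef.
  by rewrite /tterm -/(X k); congr ('C(_, _)%:R / _ ^+ _); lia.
transitivity (\sum_(1 <= k < N) \sum_(1 <= l < N) (f k l + f l k)).
  under [RHS]eq_bigr do rewrite big_split.
  rewrite big_split /= [X in _ + X]exchange_big_nat /=.
  by rewrite mulr_natl mulr2n.
under eq_bigr do under eq_bigr do rewrite fg.
under eq_bigr do rewrite -mulr_sumr sumrB.
rewrite -mulr_sumr sumrB; congr (_ * (_ - _)).
rewrite /psum mulr_sumr; apply: eq_big_nat => k /andP[k1 kN].
rewrite -gdiag -big_mkcond /= (eq_bigl (pred1 k)) => [|l]; last exact: eq_sym.
by rewrite big_nat1_eq k1 kN.
Qed.

Lemma res0_box_expand (R : realType) p q N :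
  \sum_(1 <= k < N) \sum_(1 <= l < N) res0 R p p q (k%:R - l%:R) (k%:R - 2^-1) =
  \sum_(i < p) 'C(p + i - 1, i)%:R * 'C(q + (p.-1 - i) - 1, p.-1 - i)%:R *
    (\sum_(1 <= k < N) tterm R (q + (p.-1 - i)) k
       * \sum_(1 <= l < N) ((k%:R - l%:R) ^+ (p + i))^-1).
Proof.
under eq_bigr do rewrite exchange_big /=.
rewrite exchange_big /=; apply: eq_bigr => i _.
rewrite mulr_sumr; apply: eq_bigr => k _; rewrite !mulr_sumr; apply: eq_bigr => l _.
by rewrite /invpow_coef /tterm; ring.
Qed.

Lemma res0_square_expand (R : realType) p q N :
  \sum_(1 <= k < N) \sum_(1 <= l < N) res0 R q p p (k%:R - 2^-1) (l%:R - 2^-1) =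
  \sum_(i < q) 'C(p + i - 1, i)%:R * 'C(p + (q.-1 - i) - 1, q.-1 - i)%:R *
    (psum R (tterm R (p + i)) N * psum R (tterm R (p + (q.-1 - i))) N).
Proof.
under eq_bigr do rewrite exchange_big /=.
rewrite exchange_big /=; apply: eq_bigr => i _.
rewrite /psum mulr_suml mulr_sumr; apply: eq_bigr => k _.
rewrite !mulr_sumr; apply: eq_bigr => l _.
by rewrite /invpow_coef /tterm; ring.
Qed.

(** The two sides are the limits of the two sides of [res0_box] as N grows. *)
Lemma lim_res0_box (R : realType) p q : (2 <= p)%N -> (2 <= q)%N ->
  2 * (\sum_(i < p) 'C(p + i - 1, i)%:R * 'C(q + (p.-1 - i) - 1, p.-1 - i)%:R *
         ((1 + (-1) ^+ (p + i)) * zeta R (p + i) * ttilde R (q + (p.-1 - i))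
          - 2 ^+ (p + i + (q + (p.-1 - i))) / 4
            * Tval R (p + i) (q + (p.-1 - i)))) =
  (-1) ^+ p *
    (\sum_(i < q) 'C(p + i - 1, i)%:R * 'C(p + (q.-1 - i) - 1, q.-1 - i)%:R *
       (ttilde R (p + i) * ttilde R (p + (q.-1 - i)))
     - 'C(2 * p + q - 2, q - 1)%:R * ttilde R (2 * p + q - 1)).
Proof.
move=> p2 q2; set L := LHS; set M := RHS.
pose box N : R := 2 * (\sum_(1 <= k < N) \sum_(1 <= l < N)
         res0 R p p q (k%:R - l%:R) (k%:R - 2^-1)).
have cvg_lhs : box @ \oo --> L.
  rewrite /box; under eq_fun do rewrite res0_box_expand.
  apply: cvgMl_tmp; apply: cvg_big => [|i _]; first exact: add_continuous.
  by apply: cvgMl_tmp; apply: cvg_punctured_box; lia.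
have cvg_rhs : box @ \oo --> M.
  rewrite /box; under eq_fun do (rewrite res0_box ?res0_square_expand //; last by lia).
  apply: cvgMl_tmp; apply: cvgB; last by apply: cvgMl_tmp; apply: cvg_ttilde; lia.
  apply: cvg_big => [|i _]; first exact: add_continuous; apply: cvgMl_tmp.
  by apply: cvgM; apply: cvg_ttilde; lia.
exact: (cvg_unique _ cvg_lhs cvg_rhs).
Qed.

(** * The algebra generated by the zeta values *)

Lemma smallest_Qsubalgebra (R : realType) (G : set R) :
  Qsubalgebra (smallest (@Qsubalgebra R) G).
Proof.
split=> [|a x y Gx Gy|x y Gx Gy] A [algA GA]; have [A1 Alin Amul] := algA.
- exact: A1.
- by apply: Alin; [apply: Gx|apply: Gy].
- by apply: Amul; [apply: Gx|apply: Gy].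
Qed.

Lemma Qsubalgebra_rat (R : realType) (A : set R) (a : rat) :
  Qsubalgebra A -> A (ratr a).
Proof.
move=> [A1 Alin _]; have A0 : A 0.
  by have := Alin (-1) 1 1 A1 A1; rewrite rmorphN1 mulN1r addNr.
by have := Alin a 1 0 A1 A0; rewrite mulr1 addr0.
Qed.

Lemma QsubalgebraD (R : realType) (A : set R) (x y : R) :
  Qsubalgebra A -> A x -> A y -> A (x + y).
Proof. by move=> [_ Alin _] Ax Ay; have := Alin 1 x y Ax Ay; rewrite rmorph1 mul1r. Qed.

Lemma QsubalgebraM (R : realType) (A : set R) (x y : R) :
  Qsubalgebra A -> A x -> A y -> A (x * y).
Proof. by move=> [_ _]; apply. Qed.

Lemma Qsubalgebra_sum (R : realType) (A : set R) n (f : 'I_n -> R) :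
  Qsubalgebra A -> (forall i, A (f i)) -> A (\sum_(i < n) f i).
Proof.
move=> algA Af; apply: (big_ind A) => [|x y|i _]; last exact: Af.
  by have := Qsubalgebra_rat R A 0 algA; rewrite rmorph0.
exact: QsubalgebraD.
Qed.

Lemma Qsubalgebra_nat (R : realType) (A : set R) n : Qsubalgebra A -> A n%:R.
Proof. by move=> algA; have := Qsubalgebra_rat R A n%:R algA; rewrite rmorph_nat. Qed.

Lemma Qsubalgebra_signed_power2 (R : realType) (A : set R) m n :
  Qsubalgebra A -> A ((-1) ^+ m / 2 ^+ n).
Proof.
move=> algA; have := Qsubalgebra_rat R A ((-1) ^+ m / 2 ^+ n) algA.
by rewrite rmorphM fmorphV !rmorphXn rmorphN1 rmorph_nat.
Qed.

Lemma Qzeta_zeta (R : realType) s : (2 <= s)%N -> Qzeta R (zeta R s).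
Proof. by move=> s2; apply: sub_gen_smallest; exists s. Qed.

Lemma Qzeta_ttilde (R : realType) s : (2 <= s)%N -> Qzeta R (ttilde R s).
Proof.
move=> s2; have algQ := smallest_Qsubalgebra R (zeta_values R).
rewrite ttilde_zeta //; apply: (QsubalgebraM R _ _ _ algQ); last exact: Qzeta_zeta.
have := Qsubalgebra_rat R _ (2 ^+ s - 1) algQ.
by rewrite rmorphB rmorphXn rmorph1 rmorph_nat.
Qed.

(** * The weighted sum of double T-values *)

Theorem corollary4p5 (R : realType) (p q : nat)
    (hp : (2 <= p)%N) (hq : (2 <= q)%N) :
  let S : R :=
    \sum_(i < p) \sum_(j < p | (i + j == p - 1)%N)
      'C(p + i - 1, i)%:R * 'C(q + j - 1, j)%:R * Tval R (p + i) (q + j) in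
  Qzeta R S /\
  S = (-1) ^+ p / 2 ^+ (2 * p + q - 2)
        * 'C(2 * p + q - 2, q - 1)%:R * ttilde R (2 * p + q - 1)
      + 1 / 2 ^+ (2 * p + q - 3)
        * (\sum_(i < p) \sum_(j < p | (i + j == p - 1)%N)
             'C(p + i - 1, i)%:R * 'C(q + j - 1, j)%:R
             * (1 + (-1) ^+ (p + i)) * zeta R (p + i) * ttilde R (q + j))
      - (-1) ^+ p / 2 ^+ (2 * p + q - 2)
        * (\sum_(i < q) \sum_(j < q | (i + j == q - 1)%N)
             'C(p + i - 1, i)%:R * 'C(p + j - 1, j)%:R
             * ttilde R (p + i) * ttilde R (p + j)).
Proof.
move=> S; set t := ttilde R (2 * p + q - 1); set Z := \sum_(i < p) _.
set G := \sum_(i < q) _; set c : R := 'C(2 * p + q - 2, q - 1)%:R.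
have p0 : (0 < p)%N by lia.
have q0 : (0 < q)%N by lia.
have SE := sum_antidiagonal R p (fun i j =>
  'C(p + i - 1, i)%:R * 'C(q + j - 1, j)%:R * Tval R (p + i) (q + j)) p0.
have ZE := sum_antidiagonal R p (fun i j =>
  'C(p + i - 1, i)%:R * 'C(q + j - 1, j)%:R * (1 + (-1) ^+ (p + i)) *
  zeta R (p + i) * ttilde R (q + j)) p0.
have GE := sum_antidiagonal R q (fun i j =>
  'C(p + i - 1, i)%:R * 'C(p + j - 1, j)%:R *
  ttilde R (p + i) * ttilde R (p + j)) q0.
have main : 2 * (Z - 2 ^+ (2 * p + q - 3) * S) = (-1) ^+ p * (G - c * t).
  rewrite /Z /S /G SE ZE GE mulr_sumr -sumrB.
  transitivity ((-1) ^+ p * (\sum_(i < q) 'C(p + i - 1, i)%:R *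
     'C(p + (q.-1 - i) - 1, q.-1 - i)%:R *
       (ttilde R (p + i) * ttilde R (p + (q.-1 - i))) - c * t)).
    rewrite -lim_res0_box //; congr (2 * _); apply: eq_bigr => i _.
    have -> : (p + i + (q + (p.-1 - i)) = (2 * p + q - 3).+2)%N.
      by have := ltn_ord i; lia.
    by rewrite !exprS; field.
  by congr (_ * (_ - _)); apply: eq_bigr => i _; ring.
have eqS : S = (-1) ^+ p / 2 ^+ (2 * p + q - 2) * c * t
    + 1 / 2 ^+ (2 * p + q - 3) * Z - (-1) ^+ p / 2 ^+ (2 * p + q - 2) * G.
  have -> : (2 * p + q - 2 = (2 * p + q - 3).+1)%N by lia.
  have e0 : 2 ^+ (2 * p + q - 3) != 0 :> R by rewrite expf_neq0.
  rewrite exprS; move: main e0; set e := 2 ^+ _; set s := (-1) ^+ _ => main e0.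
  have -> : S = (2 * Z - 2 * (Z - e * S)) / (2 * e) by field.
  by rewrite main; field.
split=> //; rewrite eqS.
have algQ := smallest_Qsubalgebra R (zeta_values R); rewrite -/(Qzeta R) in algQ.
have QM x y := QsubalgebraM R _ x y algQ.
have QD x y := QsubalgebraD R _ x y algQ.
have Qnat n := Qsubalgebra_nat R _ n algQ.
have Qpow m n := Qsubalgebra_signed_power2 R _ m n algQ.
have Qsign m : Qzeta R ((-1) ^+ m) by have := Qpow m 0%N; rewrite divr1.
apply: @QD; [apply: @QD|rewrite -mulN1r; apply: @QM; first exact: (Qsign 1%N)].
- by apply: QM (QM _ _ (Qpow _ _) (Qnat _)) _; apply: Qzeta_ttilde; lia.
- apply: (QM _ _ (Qpow 0%N _)); rewrite /Z ZE; apply: Qsubalgebra_sum => // i.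
  apply: @QM; last by apply: Qzeta_ttilde; lia.
  apply: @QM; last by apply: Qzeta_zeta; lia.
  exact: QM (QM _ _ (Qnat _) (Qnat _)) (QD _ _ (Qnat 1%N) (Qsign _)).
- apply: (QM _ _ (Qpow _ _)); rewrite /G GE; apply: Qsubalgebra_sum => // i.
  apply: @QM; last by apply: Qzeta_ttilde; lia.
  by apply: QM (QM _ _ (Qnat _) (Qnat _)) _; apply: Qzeta_ttilde; lia.
Qed.
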